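(* Let $F \colon \mathbb{R}^d \to \mathbb{S}^{\ell}$ be twice continuously differentiable, with components $F_{ij}$, and suppose that there exists $M > 0$ such that $\| \nabla^2 F_{ij}(x) \|_F \le M$ for all $x \in \mathbb{R}^d$ and all $i, j \in \{1, \ldots, \ell\}$. Then the mapping $F$ is DC, and for any $\mu \ge \ell M$ both pairs $(G_k, H_k)$, $k \in \{1, 2\}$, given for all $x \in \mathbb{R}^d$ by \[ G_1(x) = F(x) + \frac{\mu}{2} |x|^2 I_{\ell}, \quad H_1(x) = \frac{\mu}{2} |x|^2 I_{\ell}, \] and \[ G_2(x) = \frac{\mu}{2} |x|^2 I_{\ell}, \quad H_2(x) = \frac{\mu}{2} |x|^2 I_{\ell} - F(x), \] are DC decompositions of $F$.
   Context: $\mathbb{S}^{\ell}$ is the space of real symmetric matrices of order $\ell$, with the Löwner partial order: $A \preceq B$ iff $B - A$ is positive semidefinite. $I_\ell$ is the identity matrix, $|\cdot|$ the Euclidean norm, $\|\cdot\|_F$ the Frobenius norm. A map $F \colon \mathbb{R}^d \to \mathbb{S}^{\ell}$ is called convex if $F(\alpha x_1 + (1-\alpha) x_2) \preceq \alpha F(x_1) + (1 - \alpha) F(x_2)$ for all $x_1, x_2 \in \mathbb{R}^d$, $\alpha \in [0,1]$. $F$ is called DC if there exist convex maps $G, H \colon \mathbb{R}^d \to \mathbb{S}^{\ell}$ with $F = G - H$; any such pair $(G, H)$ is called a DC decomposition of $F$. *)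

(* Defs.v *)
From HB Require Import structures.
From mathcomp Require Import all_boot all_order all_algebra.
From mathcomp Require Import all_classical all_reals all_analysis.

Set Implicit Arguments.
Unset Strict Implicit.
Unset Printing Implicit Defensive.

Import Order.TTheory GRing.Theory Num.Theory.
Import numFieldNormedType.Exports.

Local Open Scope classical_set_scope.
Local Open Scope ring_scope.

(* R^d is 'rV[R]_d. S^l is the set of l x l real matrices
   satisfying the library predicate symmetricmx. *)

(* The norm `|_| of the library on matrices is the max norm, hence the explicit
   definitions of the Euclidean and Frobenius norms. Differentiability and
   continuity do not depend on the choice of the norm. *)
Definition enorm (R : realType) (d : nat) (x : 'rV[R]_d) : R :=
  Num.sqrt (\sum_(i < d) x 0 i ^+ 2).

Definition frobenius_norm (R : realType) (m n : nat) (A : 'M[R]_(m, n)) : R :=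
  Num.sqrt (\sum_(i < m) \sum_(j < n) A i j ^+ 2).

Definition psdmx (R : realType) (l : nat) (A : 'M[R]_l) : Prop :=
  A \is symmetricmx /\ forall v : 'cV[R]_l, 0 <= (v^T *m A *m v) 0 0.

Definition loewner_le (R : realType) (l : nat) (A B : 'M[R]_l) : Prop :=
  psdmx (B - A).

Definition symmetric_valued (R : realType) (d l : nat)
    (F : 'rV[R]_d -> 'M[R]_l) : Prop :=
  forall x, F x \is symmetricmx.

Definition convex_map (R : realType) (d l : nat)
    (F : 'rV[R]_d -> 'M[R]_l) : Prop :=
  symmetric_valued F /\
  forall (x1 x2 : 'rV[R]_d) (a : R), 0 <= a <= 1 ->
    loewner_le (F (a *: x1 + (1 - a) *: x2)) (a *: F x1 + (1 - a) *: F x2).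

Definition DC_decomposition (R : realType) (d l : nat)
    (F G H : 'rV[R]_d -> 'M[R]_l) : Prop :=
  [/\ convex_map G, convex_map H & forall x, F x = G x - H x].

Definition DC (R : realType) (d l : nat) (F : 'rV[R]_d -> 'M[R]_l) : Prop :=
  exists G H : 'rV[R]_d -> 'M[R]_l, DC_decomposition F G H.

(* For differentiable F, 'D_v F x is the value at v of the differential of F at
   x. As R^d is finite-dimensional, the map sending x to the differential of F
   at x is differentiable (resp. continuous) iff all the maps 'D_v F are;
   similarly for the second differential and the maps 'D_u ('D_v F). *)
Definition twice_continuously_differentiable (R : realType) (d m n : nat)
    (F : 'rV[R]_d -> 'M[R]_(m, n)) : Prop :=
  [/\ forall x, differentiable F x,
      forall v x, differentiable ('D_v F) x
    & forall u v, continuous ('D_u ('D_v F))].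

(* 'D is a total operator, so this is the Hessian only where f is twice
   differentiable. *)
Definition hessian (R : realType) (d : nat) (f : 'rV[R]_d -> R)
    (x : 'rV[R]_d) : 'M[R]_d :=
  \matrix_(a < d, b < d) 'D_(delta_mx 0 a) ('D_(delta_mx 0 b) f) x.

(* Main.v *)
(* For a vector v, the second derivative of v^T F v in a direction w has entries
   D_w D_w F_ij = w^T (Hess F_ij) w, bounded by M |w|^2 by Cauchy-Schwarz, so it is
   at most l M |w|^2 |v|^2 in absolute value. This is dominated by the second
   derivative mu |w|^2 |v|^2 of (mu/2) |x|^2 |v|^2, whence s F + (mu/2) |x|^2 I is
   convex for every |s| <= 1; the values s = 1, 0, -1 give the maps G_k and H_k. *)
Require Import Defs.
From HB Require Import structures.
From mathcomp Require Import all_boot all_order all_algebra.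
From mathcomp Require Import all_classical all_reals all_analysis.
From mathcomp Require Import ring.

Set Implicit Arguments.
Unset Strict Implicit.
Unset Printing Implicit Defensive.

Import Order.TTheory GRing.Theory Num.Theory.
Import numFieldNormedType.Exports.

Local Open Scope classical_set_scope.
Local Open Scope ring_scope.
Local Open Scope convex_scope.

(** * Cauchy-Schwarz for finite sums and two consequences *)

Lemma CauchySchwarz_sum (R : realDomainType) (I : finType) (a b : I -> R) :
  (\sum_i a i * b i) ^+ 2 <= (\sum_i a i ^+ 2) * (\sum_i b i ^+ 2).
Proof.
(* Lagrange's identity: the defect is doubled because the sum of squares runs over ordered pairs (i,
   j) and meets each unordered pair twice. *)
rewrite -subr_ge0 -(pmulrn_lge0 _ (ltn0Sn 1)).
suff -> : ((\sum_i a i ^+ 2) * (\sum_i b i ^+ 2) - (\sum_i a i * b i) ^+ 2) *+ 2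
    = \sum_i \sum_j (a i * b j - a j * b i) ^+ 2.
  by apply: sumr_ge0 => i _; apply: sumr_ge0 => j _; exact: sqr_ge0.
have -> : \sum_i \sum_j (a i * b j - a j * b i) ^+ 2 =
    \sum_i \sum_j a i ^+ 2 * b j ^+ 2 + \sum_i \sum_j a j ^+ 2 * b i ^+ 2
    - (\sum_i \sum_j (a i * b i) * (a j * b j)) *+ 2.
  rewrite -sumrMnl -sumrN -!big_split/=; apply: eq_bigr => i _.
  rewrite -sumrMnl -sumrN -!big_split/=; apply: eq_bigr => j _.
  by ring.
rewrite [X in _ + X - _]exchange_big/= -!big_distrlr/=.
by ring.
Qed.

(** Cauchy-Schwarz over pairs (a, b), applied to the families w_a w_b and A_ab; the sum of the (w_a
    w_b)^2 factors as |w|^4. *)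
Lemma quadratic_form_le_frobenius (R : realType) (d : nat) (A : 'M[R]_d)
    (w : 'I_d -> R) :
  `|\sum_a \sum_b w a * w b * A a b| <= frobenius_norm A * \sum_a w a ^+ 2.
Proof.
rewrite -(ler_pXn2r (ltn0Sn 1)) ?nnegrE//; last first.
  by rewrite mulr_ge0 ?sqrtr_ge0// sumr_ge0// => a _; exact: sqr_ge0.
rewrite real_normK ?num_real// pair_big/= (le_trans (CauchySchwarz_sum _ _))//.
rewrite exprMn sqr_sqrtr; last first.
  by apply: sumr_ge0 => a _; apply: sumr_ge0 => b _; exact: sqr_ge0.
rewrite -(pair_big predT predT (fun a b => A a b ^+ 2))/=.
rewrite -(pair_big predT predT (fun a b => (w a * w b) ^+ 2))/= mulrC.
suff -> : \sum_a \sum_b (w a * w b) ^+ 2 = (\sum_a w a ^+ 2) ^+ 2 by [].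
by rewrite expr2 big_distrlr/=; under eq_bigr do under eq_bigr do rewrite exprMn.
Qed.

(** Cauchy-Schwarz against the constant family 1. This is where the factor l in the threshold l M
    originates. *)
Lemma sqr_sum_normr_le (R : realDomainType) (l : nat) (v : 'I_l -> R) :
  (\sum_i `|v i|) ^+ 2 <= l%:R * \sum_i v i ^+ 2.
Proof.
have := CauchySchwarz_sum (fun i => `|v i|) (fun=> 1).
under eq_bigr do rewrite mulr1.
under [in X in _ <= X * _]eq_bigr do rewrite real_normK ?num_real//.
by rewrite expr1n sumr_const card_ord mulrC.
Qed.

(** * Convexity from second directional derivatives *)

Lemma is_derive_line (R : numFieldType) (V W : normedModType R) (f : V -> W)
    (x w : V) (t : R) (df : W) :
  is_derive (x + t *: w) w f df ->
  is_derive t (1 : R) (fun t : R => f (x + t *: w)) df.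
Proof.
have E : (fun h => h^-1 *: (((fun t => f (x + t *: w)) \o shift t) (h *: (1 : R))
     - f (x + t *: w))) =
   (fun h => h^-1 *: ((f \o shift (x + t *: w)) (h *: w) - f (x + t *: w))).
  by apply/funext => h/=; rewrite [h *: 1]mulr1 scalerDl addrCA.
by move=> [df1 df2]; split; rewrite ?/derivable ?/derive E.
Qed.

(** Restricting [f] to the line through x and y reduces the claim to the second derivative test in
    one variable; [df w] and [ddf w] are the first and second derivatives along the same direction
    w. *)
Lemma convex_of_derive2_ge0 (R : realType) (V : normedModType R) (f : V -> R)
    (df ddf : V -> V -> R) :
  (forall w x, is_derive x w f (df w x)) ->
  (forall w x, is_derive x w (df w) (ddf w x)) ->
  (forall w x, 0 <= ddf w x) ->
  forall (x y : V) (a : R), 0 <= a <= 1 ->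
    f (a *: x + (1 - a) *: y) <= a * f x + (1 - a) * f y.
Proof.
move=> fE dfE ddf0 x y a /andP[a0 a1].
pose w := y - x; pose g (t : R) : R^o := f (x + t *: w).
have gE (t : R) : is_derive t (1 : R) g (df w (x + t *: w)).
  exact: is_derive_line.
have DgE : 'D_1 g = fun t => df w (x + t *: w).
  by apply/funext => t; rewrite derive_val.
have DgE' (t : R) : is_derive t (1 : R) ('D_1 g) (ddf w (x + t *: w)).
  by rewrite DgE; exact: is_derive_line.
have gc : continuous g.
  move=> t; apply/differentiable_continuous/derivable1_diffP.
  exact: ex_derive.
have cvx (t : {i01 R}) : g ((0 : R^o) <| t |> 1) <= g 0 <| t |> g 1.
  apply: second_derivative_convex => //.
  - by move=> s _; rewrite derive_val.
  - by apply: cvg_at_left_filter; exact: gc.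
  - by apply: cvg_at_right_filter; exact: gc.
(* The weight [a] falls on the endpoint 0, so the inequality is read at parameter 1 - a, where x +
   (1 - a) (y - x) = a x + (1 - a) y. *)
have := cvx (Itv01 a0 a1).
rewrite !convRE/= /unstable.onem mulr0 add0r mulr1 /g scale0r addr0 scale1r.
rewrite [x + w]addrC subrK.
suff -> : x + (1 - a) *: w = a *: x + (1 - a) *: y by [].
by rewrite /w scalerBr addrCA addrC -{1}[x]scale1r -scalerBl subKr addrC.
Qed.

(** * Differentiating entries and quadratic forms of matrix-valued maps *)

Section matrix_valued.
Context {R : realType} {V : normedModType R}.

Lemma is_derive_coord (m n : nat) (G : V -> 'M[R]_(m, n)) x w dG i j :
  is_derive x w G dG -> is_derive x w (fun y => G y i j) (dG i j).
Proof.
move=> [dG1 <-]; split; first exact: (derivable_mxP _ _ _).1.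
by rewrite derive_mx// mxE.
Qed.

Lemma quadratic_formE (l : nat) (A : 'M[R]_l) (v : 'cV[R]_l) :
  (v^T *m A *m v) 0 0 = \sum_i \sum_j v i 0 * v j 0 * A i j.
Proof.
rewrite mxE exchange_big/=; apply: eq_bigr => j _.
rewrite mxE big_distrl/=; apply: eq_bigr => i _.
by rewrite mxE mulrAC.
Qed.

(** For fixed v the form is a linear combination of the entries of [G] with constant coefficients
    v_i v_j. *)
Lemma is_derive_quadratic_form (l : nat) (G : V -> 'M[R]_l) x w dG
    (v : 'cV[R]_l) :
  is_derive x w G dG ->
  is_derive x w (fun y => (v^T *m G y *m v) 0 0) ((v^T *m dG *m v) 0 0).
Proof.
move=> GE; rewrite quadratic_formE.
have -> : (fun y => (v^T *m G y *m v) 0 0) =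
    \sum_i \sum_j (v i 0 * v j 0) \*: (fun y => G y i j).
  apply/funext => y; rewrite quadratic_formE fct_sumE; apply: eq_bigr => i _.
  by rewrite fct_sumE.
apply: is_derive_sum => i; apply: is_derive_sum => j.
by apply: is_deriveZ; exact: is_derive_coord.
Qed.

End matrix_valued.

(** * Derivatives of the squared Euclidean norm, and the Hessian *)

Section euclidean.
Context {R : realType} {d : nat}.
Implicit Types (f : 'rV[R]_d -> R) (x w : 'rV[R]_d).

Lemma enorm_sqr x : enorm x ^+ 2 = \sum_a x 0 a ^+ 2.
Proof. by rewrite sqr_sqrtr// sumr_ge0// => a _; exact: sqr_ge0. Qed.

Lemma is_derive_enorm_sqr x w :
  is_derive x w (fun y => enorm y ^+ 2) (\sum_a 2 * w 0 a * x 0 a).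
Proof.
have -> : (fun y : 'rV[R]_d => enorm y ^+ 2) =
    \sum_a ((fun y : 'rV[R]_d => y 0 a) ^+ 2).
  apply/funext => y; rewrite enorm_sqr fct_sumE; apply: eq_bigr => a _.
  by rewrite expr2.
apply: is_derive_sum => a.
have h : is_derive x w (fun y : 'rV[R]_d => y 0 a) (w 0 a).
  exact: is_derive_coord.
by apply: is_derive_eq; rewrite /= /GRing.scale/=; ring.
Qed.

Lemma is_derive_dot (u : 'rV[R]_d) x w :
  is_derive x w (fun y => \sum_a u 0 a * y 0 a) (\sum_a u 0 a * w 0 a).
Proof.
have -> : (fun y : 'rV[R]_d => \sum_a u 0 a * y 0 a) =
    \sum_a (u 0 a) \*: (fun y : 'rV[R]_d => y 0 a).
  by apply/funext => y; rewrite fct_sumE.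
by apply: is_derive_sum => a; apply: is_deriveZ; exact: is_derive_coord.
Qed.

Lemma derive_delta f x w : differentiable f x ->
  'D_w f x = \sum_a w 0 a * 'D_(delta_mx 0 a) f x.
Proof.
move=> df; rewrite deriveE// {1}[w]row_sum_delta linear_sum/=.
by apply: eq_bigr => a _; rewrite linearZ/= deriveE.
Qed.

Lemma derive2_hessian f x w :
  (forall y, differentiable f y) ->
  (forall a y, differentiable ('D_(delta_mx 0 a) f) y) ->
  'D_w ('D_w f) x = \sum_a \sum_b w 0 a * w 0 b * hessian f x a b.
Proof.
move=> df ddf.
have -> : 'D_w f = \sum_b w 0 b \*: 'D_(delta_mx 0 b) f.
  by apply/funext => y; rewrite derive_delta// fct_sumE.
rewrite derive_sum => [|b]; last by apply: derivableZ; exact: diff_derivable.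
(* The row index a of [hessian] belongs to the outer derivative, whereas the expansion of the inner
   one has put the sum over b outside. *)
rewrite exchange_big/=; apply: eq_bigr => b _.
rewrite deriveZ; last exact: diff_derivable.
rewrite derive_delta// scaler_sumr; apply: eq_bigr => a _.
by rewrite mxE /GRing.scale/= mulrCA mulrA.
Qed.

End euclidean.

Lemma quadratic_form_le_entries (R : realType) (l : nat) (A : 'M[R]_l)
    (v : 'cV[R]_l) (K : R) :
  0 <= K -> (forall i j, `|A i j| <= K) ->
  `|(v^T *m A *m v) 0 0| <= l%:R * K * \sum_i v i 0 ^+ 2.
Proof.
move=> K0 AK; rewrite quadratic_formE.
apply: (@le_trans _ _ (K * (\sum_i `|v i 0|) ^+ 2)); last first.
  by rewrite mulrAC [leRHS]mulrC ler_wpM2l// sqr_sum_normr_le.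
rewrite expr2 big_distrlr/= mulr_sumr (le_trans (ler_norm_sum _ _ _))//.
apply: ler_sum => i _; rewrite mulr_sumr (le_trans (ler_norm_sum _ _ _))//.
by apply: ler_sum => j _; rewrite !normrM mulrC ler_wpM2r.
Qed.

Lemma symmetricmxE (R : realType) (l : nat) (A : 'M[R]_l) :
  (A \is symmetricmx) = (A^T == A).
Proof. by rewrite is_hermitianmxE expr0 scale1r map_mx_id// eq_sym. Qed.

(** Scalarization: the Löwner order is tested on one vector v at a time, so convexity of [F] reduces
    to that of the real functions x -> v^T F(x) v. *)
Lemma convex_map_quadratic_form (R : realType) (d l : nat)
    (F : 'rV[R]_d -> 'M[R]_l) :
  symmetric_valued F ->
  (forall (v : 'cV[R]_l) (x y : 'rV[R]_d) (a : R), 0 <= a <= 1 ->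
    (v^T *m F (a *: x + (1 - a) *: y) *m v) 0 0 <=
    a * (v^T *m F x *m v) 0 0 + (1 - a) * (v^T *m F y *m v) 0 0) ->
  convex_map F.
Proof.
move=> Fs Fc; split=> // x y a a01; split.
  have FT z : (F z)^T = F z by apply/eqP; rewrite -symmetricmxE; exact: Fs.
  by rewrite symmetricmxE linearB linearD !linearZ/= !FT.
move=> v; have := Fc v x y a a01; rewrite -subr_ge0 => /le_trans; apply.
rewrite mulmxBr mulmxBl mulmxDr mulmxDl -!scalemxAr -!scalemxAl.
by rewrite !mxE.
Qed.

(** * Convexity of the quadratic perturbations of [F] *)

Section bounded_hessian.
Context {R : realType} {d l : nat} (F : 'rV[R]_d -> 'M[R]_l) (M : R).
Hypothesis F_sym : symmetric_valued F.
Hypothesis F_C2 : twice_continuously_differentiable F.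
Hypothesis M_ge0 : 0 <= M.
Hypothesis F_hess : forall (x : 'rV[R]_d) (i j : 'I_l),
  frobenius_norm (hessian (fun y => F y i j) x) <= M.

Lemma is_derive_C2 w x : is_derive x w F ('D_w F x).
Proof. by case: F_C2 => dF _ _; apply/derivableP/diff_derivable. Qed.

Lemma is_derive2_C2 w x : is_derive x w ('D_w F) ('D_w ('D_w F) x).
Proof. by case: F_C2 => _ ddF _; apply/derivableP/diff_derivable. Qed.

Lemma derive_entry w i j :
  'D_w (fun y => F y i j) = fun y => 'D_w F y i j.
Proof.
apply/funext => y.
have := @is_derive_coord R _ _ _ F y w _ i j (is_derive_C2 w y).
by move=> ?; rewrite derive_val.
Qed.

(** Directional derivatives commute with taking entries, so the left side is the Hessian form of
    F_ij at w, which its Frobenius norm controls. *)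
Lemma derive2_entry_le w x i j :
  `|'D_w ('D_w F) x i j| <= M * \sum_a w 0 a ^+ 2.
Proof.
have [dF ddF _] := F_C2.
have -> : 'D_w ('D_w F) x i j = 'D_w ('D_w (fun y => F y i j)) x.
  rewrite derive_entry.
  have := @is_derive_coord R _ _ _ ('D_w F) x w _ i j (is_derive2_C2 w x).
  by move=> ?; rewrite derive_val.
rewrite derive2_hessian => [|y|a y].
- rewrite (le_trans (quadratic_form_le_frobenius _ (w 0)))//.
  by rewrite ler_wpM2r// sumr_ge0// => a _; exact: sqr_ge0.
- exact: (differentiable_comp (dF y) (differentiable_coord _ i j)).
- rewrite derive_entry.
  exact: (differentiable_comp (ddF _ y) (differentiable_coord _ i j)).
Qed.

Lemma convex_map_add_enorm_sqr (s mu : R) :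
  `|s| <= 1 -> l%:R * M <= mu ->
  convex_map (fun x => s *: F x + (mu / 2 * enorm x ^+ 2) *: 1%:M).
Proof.
move=> s1 lM; apply: convex_map_quadratic_form.
  move=> x; rewrite symmetricmxE linearD !linearZ/= trmx1.
  by move: (F_sym x); rewrite symmetricmxE => /eqP ->.
move=> v; pose V2 := \sum_i v i 0 ^+ 2.
have V2_ge0 : 0 <= V2 by apply: sumr_ge0 => i _; exact: sqr_ge0.
pose q (A : 'M[R]_l) := (v^T *m A *m v) 0 0.
(* The quadratic form at v of the perturbed map, with |v|^2 = [V2] factored out of the identity
   term. *)
pose f := (s \*: (fun x => q (F x))) +
  (mu / 2 * V2) \*: (fun x : 'rV[R]_d => enorm x ^+ 2).
have fE x : (v^T *m (s *: F x + (mu / 2 * enorm x ^+ 2) *: 1%:M) *m v) 0 0 = f x.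
  rewrite mulmxDr mulmxDl -!scalemxAr -!scalemxAl mulmx1 mxE [X in X + _]mxE.
  congr (_ + _); rewrite mxE [(v^T *m v) _ _]mxE.
  rewrite /= /GRing.scale/= mulrAC; congr (_ * _ * _).
  by apply: eq_bigr => i _; rewrite mxE expr2.
move=> x y a a01; rewrite !fE.
apply: (@convex_of_derive2_ge0 _ _ f
  (fun w x => s * q ('D_w F x) + (mu / 2 * V2) * \sum_a 2 * w 0 a * x 0 a)
  (fun w x => s * q ('D_w ('D_w F) x) +
              (mu / 2 * V2) * \sum_a 2 * w 0 a * w 0 a) _ _ _ x y a a01) => w {}x.
- apply: is_deriveD; apply: is_deriveZ.
    by apply: is_derive_quadratic_form; exact: is_derive_C2.
  exact: is_derive_enorm_sqr.
- apply: is_deriveD; apply: is_deriveZ.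
    by apply: is_derive_quadratic_form; exact: is_derive2_C2.
  (* For fixed w, the first derivative of |x|^2 is the linear form x -> <2w, x>. *)
  have := is_derive_dot (2 *: w) x w.
  under eq_fun do under eq_bigr do rewrite mxE.
  by under eq_bigr do rewrite mxE.
- pose W2 := \sum_a w 0 a ^+ 2.
  have W2_ge0 : 0 <= W2 by apply: sumr_ge0 => i _; exact: sqr_ge0.
  have -> : \sum_a 2 * w 0 a * w 0 a = 2 * W2.
    by rewrite mulr_sumr; apply: eq_bigr => b _; rewrite -mulrA expr2.
  have qle : `|q ('D_w ('D_w F) x)| <= l%:R * (M * W2) * V2.
    apply: quadratic_form_le_entries; first exact: mulr_ge0.
    by move=> i j; exact: derive2_entry_le.
  (* Here |s| <= 1 removes the factor [s], the entry bound M |w|^2 gives l M |w|^2 |v|^2, and l M <=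
     mu concludes. *)
  have sq : `|s * q ('D_w ('D_w F) x)| <= mu * W2 * V2.
    rewrite normrM (le_trans (ler_piMl _ s1))// (le_trans qle)//.
    by rewrite mulrA !ler_wpM2r.
  have -> : mu / 2 * V2 * (2 * W2) = mu * W2 * V2 by field.
  (* The lower half of the absolute value bound says exactly that the sum of the two second
     derivatives is nonnegative. *)
  by move: sq; rewrite ler_norml => /andP[+ _]; rewrite -subr_ge0 opprK.
Qed.

End bounded_hessian.

Theorem theorem1 (R : realType) (d l : nat) (F : 'rV[R]_d -> 'M[R]_l) (M : R)
    (F_sym : symmetric_valued F)
    (F_C2 : twice_continuously_differentiable F)
    (M_gt0 : 0 < M)
    (F_hess : forall (x : 'rV[R]_d) (i j : 'I_l),
       frobenius_norm (hessian (fun y => F y i j) x) <= M) :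
  DC F /\
  forall mu : R, l%:R * M <= mu ->
    DC_decomposition F
      (fun x => F x + (mu / 2 * enorm x ^+ 2) *: 1%:M)
      (fun x => (mu / 2 * enorm x ^+ 2) *: 1%:M) /\
    DC_decomposition F
      (fun x => (mu / 2 * enorm x ^+ 2) *: 1%:M)
      (fun x => (mu / 2 * enorm x ^+ 2) *: 1%:M - F x).
Proof.
have cvx := convex_map_add_enorm_sqr F_sym F_C2 (ltW M_gt0) F_hess.
have dec mu : l%:R * M <= mu ->
    DC_decomposition F
      (fun x => F x + (mu / 2 * enorm x ^+ 2) *: 1%:M)
      (fun x => (mu / 2 * enorm x ^+ 2) *: 1%:M) /\
    DC_decomposition F
      (fun x => (mu / 2 * enorm x ^+ 2) *: 1%:M)
      (fun x => (mu / 2 * enorm x ^+ 2) *: 1%:M - F x).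
  move=> lM.
  have G1 : convex_map (fun x => F x + (mu / 2 * enorm x ^+ 2) *: 1%:M).
    have := cvx 1 mu; rewrite normr1 => /(_ (lexx _) lM).
    by under eq_fun do rewrite scale1r.
  have H1 : convex_map (fun x : 'rV[R]_d => (mu / 2 * enorm x ^+ 2) *: (1%:M : 'M[R]_l)).
    have := cvx 0 mu; rewrite normr0 => /(_ ler01 lM).
    by under eq_fun do rewrite scale0r add0r.
  have H2 : convex_map (fun x => (mu / 2 * enorm x ^+ 2) *: 1%:M - F x).
    have := cvx (-1) mu; rewrite normrN1 => /(_ (lexx _) lM).
    by under eq_fun do rewrite scaleN1r addrC.
  by split; split=> // x; rewrite ?addrK ?subKr.
(* The smallest admissible value mu = l M provides the witnesses for [DC F]. *)
split=> //; have [dec1 _] := dec _ (lexx _).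
by do 2!eexists; exact: dec1.
Qed.
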